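(* Let $T$ be a countable tree of sequences and let $\lambda$ be a probability measure on the Borel $\sigma$-algebra $\mathcal B([T])$. If $\lambda$ is free then $\mathcal N(\lambda)=_{\mathrm T}\mathcal N([0,1])$ and $\mathsf{Cv}_{\mathcal N(\lambda)}=_{\mathrm T}\mathsf{Cv}_{\mathcal N([0,1])}$.
   Context: A tree (of sequences) is a non-empty set $T$ of finite sequences with entries in some set, closed under initial segments and ordered by $s\subseteq t$ ($t$ extends $s$). $\max T$ is the set of nodes of $T$ with no proper extension in $T$; $\lim T$ is the set of infinite sequences $x$ (indexed by $\omega$) with $x\upharpoonright n\in T$ for all $n<\omega$; $[T]=\lim T\cup\max T$, with the topology generated by the sets $[t]_T=\{x\in[T]:t\subseteq x\}$, $t\in T$. A measure is free if every singleton is measurable with measure $0$. For a measure $\mu$ on a $\sigma$-algebra $\mathcal A$ over $X$, $\mathcal N(\mu)=\{N\subseteq X:\exists A\in\mathcal A\ (N\subseteq A,\ \mu(A)=0)\}$; $\mathcal N([0,1])$ is the ideal of Lebesgue null subsets of $[0,1]$. A relational system is a triple $R=\langle X,Y,\lhd\rangle$ with $X,Y$ non-empty sets and $\lhd$ a relation. For $R=\langle X,Y,\lhd\rangle$ and $S=\langle Z,W,\sqsubset\rangle$, $R\leq_{\mathrm T}S$ means that there are functions $\psi_-\colon X\to Z$ and $\psi_+\colon W\to Y$ such that, for all $x\in X$ and $w\in W$, $\psi_-(x)\sqsubset w$ implies $x\lhd\psi_+(w)$ (a Tukey connection). $R=_{\mathrm T}S$ (Tukey equivalence) means $R\leq_{\mathrm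 T}S$ and $S\leq_{\mathrm T}R$. An ideal $\mathcal I$ on a set $X$ is regarded as the relational system $\langle\mathcal I,\mathcal I,\subseteq\rangle$, and $\mathsf{Cv}_{\mathcal I}=\langle X,\mathcal I,\in\rangle$. *)

(* Defs.v *)
From HB Require Import structures.
From mathcomp Require Import all_boot all_order all_algebra.
From mathcomp Require Import all_classical all_reals all_analysis.

Set Implicit Arguments.
Unset Strict Implicit.
Unset Printing Implicit Defensive.

Import Order.TTheory GRing.Theory Num.Theory.
Import numFieldNormedType.Exports.
Local Open Scope classical_set_scope.
Local Open Scope ring_scope.

(* [take (size s) t = s] is s `<=` t for finite sequences: the restriction of
   t to the length of s is s.  Unlike [prefix], this needs no eqType on A. *)
Definition initseg (A : Type) (s t : seq A) : Prop := take (size s) t = s.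

Record tree (A : Type) := Tree {
  nodes :> set (seq A);
  tree_neq0 : nodes !=set0;
  tree_initseg : forall s t, initseg s t -> nodes t -> nodes s
}.

Definition max_nodes (A : Type) (T : tree A) : set (seq A) :=
  [set t | nodes T t /\ forall u, nodes T u -> initseg t u -> u = t].

(* [mkseq x n] is the restriction of x to n. *)
Definition lim_tree (A : Type) (T : tree A) : set (nat -> A) :=
  [set x | forall n, nodes T (mkseq x n)].

(* Sequences of length at most omega are the elements of the disjoint union
   [seq A + (nat -> A)]. *)
Definition branches (A : Type) (T : tree A) : set (seq A + (nat -> A)) :=
  inr @` lim_tree T `|` inl @` max_nodes T.

Definition initseg_branch (A : Type) (s : seq A) (x : seq A + (nat -> A)) :=
  match x with
  | inl t => initseg s t
  | inr f => mkseq f (size s) = s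
  end.

Lemma branches_neq0 (A : Type) (T : tree A) : branches T !=set0.
Proof.
have [[t Tmax]|nomax] := pselect (max_nodes T !=set0).
  by exists (inl t); right; exists t.
have take_node s n : nodes T s -> nodes T (take n s).
  move=> Ts; apply: (tree_initseg _ Ts); rewrite /initseg size_take.
  by case: ltnP => // sn; rewrite take_size take_oversize.
have ext s : nodes T s -> exists a, nodes T (rcons s a).
  move=> Ts; apply: contrapT => noext; apply: nomax; exists s; split=> // u Tu.
  rewrite /initseg => su; have [us|su'] := leqP (size u) (size s).
    by move: su; rewrite take_oversize.
  exfalso; apply: noext.
  have a : A by case: u {Tu su} su' => [|a u _] //; exact: a.
  exists (nth a u (size s)); rewrite -[X in rcons X]su -take_nth //.
  exact: take_node.
have T0 : nodes T [::].
  by have [s /(take_node _ 0%N)] := tree_neq0 T; rewrite take0.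
have [a0 _] := ext _ T0.
have /choice[g gP] : forall s, exists a, nodes T s -> nodes T (rcons s a).
  move=> s; have [/ext[a Ta]|] := pselect (nodes T s); first by exists a.
  by exists a0.
pose p n := iter n (fun s => rcons s (g s)) [::].
exists (inr (fun n => g (p n))); left; exists (fun n => g (p n)) => //= n.
suff -> : mkseq (fun n => g (p n)) n = p n by elim: n => //= n; exact: gP.
by elim: n => // n IH; rewrite mkseqS IH.
Qed.

Definition branch_space (A : Type) (T : tree A) : Type := branches T.

Definition cone (A : Type) (T : tree A) (t : seq A) : set (branch_space T) :=
  [set x | initseg_branch t (\val x)].
Arguments cone {A} T t.

Definition branch_point (A : Type) (T : tree A) : branch_space T :=
  let: exist x xT := cid (branches_neq0 T) in exist _ x (mem_set xT).

HB.instance Definition _ (A : Type) (T : tree A) :=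
  gen_eqMixin (branch_space T).
HB.instance Definition _ (A : Type) (T : tree A) :=
  gen_choiceMixin (branch_space T).
HB.instance Definition _ (A : Type) (T : tree A) :=
  isPointed.Build (branch_space T) (branch_point T).
HB.instance Definition _ (A : Type) (T : tree A) :=
  @isSubBaseTopological.Build (branch_space T)
    (set (branch_space T)) [set cone T t | t in nodes T] id.

Definition borel_branch_space (A : Type) (T : tree A) :=
  g_sigma_algebraType (@open (branch_space T)).
HB.instance Definition _ (A : Type) (T : tree A) :=
  Measurable.on (borel_branch_space T).

Definition free_measure (d : measure_display) (X : measurableType d)
    (R : realType) (mu : {measure set X -> \bar R}) : Prop :=
  forall x : X, measurable [set x] /\ mu [set x] = 0%E.

Record relsys := RelSys {
  rs_left : Type;
  rs_right : Type;
  rs_rel : rs_left -> rs_right -> Prop;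
  rs_left_neq0 : inhabited rs_left;
  rs_right_neq0 : inhabited rs_right
}.

Definition tukey_le (R S : relsys) : Prop :=
  exists (psim : rs_left R -> rs_left S) (psip : rs_right S -> rs_right R),
    forall x w, rs_rel (psim x) w -> rs_rel x (psip w).

Definition tukey_eq (R S : relsys) : Prop := tukey_le R S /\ tukey_le S R.

Record ideal (U : Type) (X : set U) := Ideal {
  ideal_set :> set (set U);
  ideal_sub : forall N, ideal_set N -> N `<=` X;
  ideal0 : ideal_set set0;
  idealS : forall M N, M `<=` N -> ideal_set N -> ideal_set M;
  idealU : forall M N, ideal_set M -> ideal_set N -> ideal_set (M `|` N)
}.

Lemma set_type_inhabited (U : Type) (X : set U) : X !=set0 -> inhabited X.
Proof. by move=> [x Xx]; constructor; exists x; exact: mem_set. Qed.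

Lemma ideal_inhabited (U : Type) (X : set U) (I : ideal X) : inhabited I.
Proof. by apply: set_type_inhabited; exists set0; exact: ideal0. Qed.

Definition ideal_relsys (U : Type) (X : set U) (I : ideal X) : relsys :=
  @RelSys I I (fun M N => \val M `<=` \val N)
    (ideal_inhabited I) (ideal_inhabited I).

Definition Cv (U : Type) (X : set U) (I : ideal X) (X0 : X !=set0) : relsys :=
  @RelSys X I (fun x N => (\val N) (\val x))
    (set_type_inhabited X0) (ideal_inhabited I).

Section null_ideal.
Context (d : measure_display) (X : measurableType d) (R : realType).
Variable mu : {measure set X -> \bar R}.

Let null_sub (N : set X) : mu.-negligible N -> N `<=` setT.
Proof. by []. Qed.

Let nullS (M N : set X) :
  M `<=` N -> mu.-negligible N -> mu.-negligible M.
Proof. exact: negligibleS. Qed.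

Let nullU (M N : set X) :
  mu.-negligible M -> mu.-negligible N -> mu.-negligible (M `|` N).
Proof. exact: negligibleU. Qed.

Definition null_ideal : ideal [set: X] :=
  @Ideal X setT mu.-negligible null_sub (negligible_set0 mu) nullS nullU.

End null_ideal.

Section null01.
Variable R : realType.

Let null01 : set (set R) :=
  [set N | N `<=` `[0, 1]%classic /\ (@lebesgue_measure R).-negligible N].

Let null01_sub N : null01 N -> N `<=` `[0, 1]%classic.
Proof. by case. Qed.

Let null01_set0 : null01 set0.
Proof. by split; [exact: sub0set | exact: negligible_set0]. Qed.

Let null01S M N : M `<=` N -> null01 N -> null01 M.
Proof.
by move=> MN [N1 N0]; split; [exact: subset_trans N1 | exact: negligibleS N0].
Qed.

Let null01U M N : null01 M -> null01 N -> null01 (M `|` N).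
Proof.
move=> [M1 M0] [N1 N0]; split; last exact: negligibleU.
by move=> x [/M1|/N1].
Qed.

Definition null01_ideal : ideal (`[0, 1]%classic : set R) :=
  Ideal null01_sub null01_set0 null01S null01U.

End null01.

Lemma itv01_neq0 (R : realType) : (`[0, 1]%classic : set R) !=set0.
Proof. by exists 0; rewrite /= in_itv /= lexx ler01. Qed.

Lemma pointed_setT_neq0 (X : pointedType) : [set: X] !=set0.
Proof. by exists point. Qed.

(* Main.v *)
(* Give each node t the interval [lo t, hi t[ of length lambda(cone t), where
   lo t is the measure of the set of branches lying to the left of t in the
   lexicographic order induced by an enumeration e of the nodes.  The intervals
   of the children of t partition that of t, since only the possible leaf t is
   lost and lambda is free.  Following nested intervals gives a map g from
   [0, 1[ to the infinite branches whose preimage of a cone is the interval of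
   its node, so that g maps Lebesgue measure to lambda.  As lambda(cone t)
   tends to 0 along each branch in the range of g, the supremum f x of lo t
   over the nodes t of x satisfies f (g y) = y.  Hence {x | g (f x) <> x} is
   null, both f and g pull null sets back to null sets, and preimages under f
   and g, enlarged by the null sets where the maps fail to be inverse, are the
   Tukey connections. *)
Require Import Defs.
From HB Require Import structures.
From mathcomp Require Import finmap.
From mathcomp Require Import all_boot all_order all_algebra.
From mathcomp Require Import all_classical all_reals all_analysis.

Set Implicit Arguments.
Unset Strict Implicit.
Unset Printing Implicit Defensive.

Import Order.TTheory GRing.Theory Num.Theory.
Local Open Scope classical_set_scope.

(** * Initial segments, cones and the topology of the branch space *)

Section tree_combinatorics.
Context (A : Type).
Implicit Types s t u : seq A.

Lemma initseg_refl s : initseg s s.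
Proof. by rewrite /initseg take_size. Qed.

Lemma initseg_size s t : initseg s t -> size s <= size t.
Proof. by move=> <-; rewrite size_take_min geq_minr. Qed.

Lemma initseg_trans s t u : initseg s t -> initseg t u -> initseg s u.
Proof.
move=> st; have := initseg_size st; move: st; rewrite /initseg => st stle tu.
by rewrite -[RHS]st -[in RHS]tu take_takel.
Qed.

Lemma initseg_total s t u :
  initseg s u -> initseg t u -> size s <= size t -> initseg s t.
Proof. by move=> su tu st; rewrite /initseg -tu take_takel. Qed.

Lemma initseg_anti s t : initseg s t -> size t <= size s -> s = t.
Proof. by move=> st ts; rewrite -st take_oversize. Qed.

Lemma initseg_rcons s t a : initseg s (rcons t a) -> s = rcons t a \/ initseg s t.
Proof.
move=> st; have := initseg_size st; rewrite size_rcons leq_eqVlt.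
case/predU1P => [e|le]; [left|right].
  by apply: initseg_anti => //; rewrite size_rcons e.
by move: st; rewrite /initseg -cats1 takel_cat.
Qed.

Lemma rcons_initseg t a : initseg t (rcons t a).
Proof. by rewrite /initseg -cats1 take_size_cat. Qed.

Lemma initseg_mkseq (f : nat -> A) n m : n <= m -> initseg (mkseq f n) (mkseq f m).
Proof.
move=> nm; rewrite /initseg size_mkseq /mkseq -map_take take_iota.
by rewrite (minn_idPl nm).
Qed.

Variable T : tree A.

Definition child t s := nodes T s /\ exists a, s = rcons t a.

Lemma node_nil : nodes T [::].
Proof.
have [s Ts] := tree_neq0 T; apply: (tree_initseg _ Ts).
by rewrite /initseg take0.
Qed.

(** Case analysis on a branch that hides the subtype and hands over, with each case, the description
    of the cones through it. *)
Variant branch_spec (x : branch_space T) : Prop :=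
| LeafBranch t of max_nodes T t & sval x = inl t
    & (forall s, cone T s x <-> initseg s t)
| LimBranch f of lim_tree T f & sval x = inr f
    & (forall s, cone T s x <-> mkseq f (size s) = s).

Lemma branchP x : branch_spec x.
Proof.
have [[f Tf fx]|[t Tt tx]] := set_valP x.
  by apply: (@LimBranch x f) => // s; rewrite /cone /= (esym fx : sval x = _).
by apply: (@LeafBranch x t) => // s; rewrite /cone /= (esym tx : sval x = _).
Qed.

Lemma cone_nil : cone T [::] = setT.
Proof.
apply/seteqP; split=> // x _.
by case: (branchP x) => [t _ _|f _ _] -> //; rewrite /initseg take0.
Qed.

Lemma coneS s t : initseg s t -> cone T t `<=` cone T s.
Proof.
move=> st x; case: (branchP x) => [u _ _|f _ _] H.
  by move=> /H tu; apply/H; exact: initseg_trans tu.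
move=> /H ft; apply/H; rewrite -[RHS]st -ft; have := initseg_size st.
by move=> /(initseg_mkseq f) <-; rewrite size_mkseq.
Qed.

Lemma cone_initseg s t x : cone T s x -> cone T t x -> size s <= size t ->
  initseg s t.
Proof.
case: (branchP x) => [u _ _|f _ _] H.
  by move=> /H + /H; exact: initseg_total.
by move=> /H <- /H <-; rewrite !size_mkseq; exact: initseg_mkseq.
Qed.

Lemma cone_size_inj s t x : cone T s x -> cone T t x -> size s = size t -> s = t.
Proof.
move=> sx tx st; apply: initseg_anti; last by rewrite st.
by apply: cone_initseg sx tx _; rewrite st.
Qed.

Lemma cone_child t x : nodes T t -> cone T t x ->
  sval x = inl t \/ exists2 s, child t s & cone T s x.
Proof.
move=> Tt; case: (branchP x) => [u [Tu _] xu H /H tu|f Tf _ H /H ft].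
  have [ut|ts] := leqP (size u) (size t).
    by left; rewrite (initseg_anti tu ut).
  have uE : initseg (take (size t).+1 u) u.
    by rewrite /initseg size_take_min (minn_idPl ts).
  right; exists (take (size t).+1 u); last exact/H.
  split; first exact: tree_initseg Tu.
  (* [u] is longer than [t], so one of its entries can serve as the default value of [nth]. *)
  have a : A by case: u ts {Tu xu H tu uE}.
  by exists (nth a u (size t)); rewrite (take_nth a)// tu.
right; exists (mkseq f (size t).+1); last by apply/H; rewrite size_mkseq.
by split; [exact: Tf|exists (f (size t)); rewrite mkseqS ft].
Qed.

Lemma cone_sep (x y : branch_space T) :
  (forall t, nodes T t -> cone T t x <-> cone T t y) -> x = y.
Proof.
move=> xy; apply: val_inj; move: xy.
(* A leaf and an infinite branch are separated by the node of length [(size s).+1] on the infinite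
   branch, which is too long to lie below [s]. *)
have lim_leaf s f (u v : branch_space T) : lim_tree T f ->
    (forall t, cone T t u <-> initseg t s) ->
    (forall t, cone T t v <-> mkseq f (size t) = t) ->
    ~ (forall t, nodes T t -> cone T t u <-> cone T t v).
  move=> Tf Hu Hv /(_ _ (Tf (size s).+1)); case=> _.
  move/(_ ((Hv _).2 _)); rewrite size_mkseq => /(_ erefl) /Hu.
  by move/initseg_size; rewrite size_mkseq ltnn.
case: (branchP x) (branchP y) => [s [Ts _] xs Hx|f Tf xf Hx]
    [t [Tt _] yt Hy|h Th yh Hy] xy.
- have st := (Hy _).1 ((xy _ Ts).1 ((Hx _).2 (initseg_refl _))).
  have ts := (Hx _).1 ((xy _ Tt).2 ((Hy _).2 (initseg_refl _))).
  by rewrite [LHS]xs [RHS]yt (initseg_anti st (initseg_size ts)).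
- by case: (lim_leaf _ _ _ _ Th Hx Hy).
- by case: (lim_leaf _ _ _ _ Tf Hy Hx) => u /xy; case.
- rewrite [LHS]xf [RHS]yh; congr inr; apply/funext => n.
  have := (Hy _).1 ((xy _ (Tf n.+1)).1 ((Hx _).2 _)); rewrite size_mkseq.
  by move=> /(_ erefl); rewrite !mkseqS => /rcons_inj[].
Qed.

Lemma lim_tree_branch f : lim_tree T f ->
  exists x : branch_space T, forall t, cone T t x <-> mkseq f (size t) = t.
Proof.
move=> Tf; have Bf : branches T (inr f) by left; exists f.
by exists (exist _ (inr f) (mem_set Bf)).
Qed.

(** The subbase gives a finite intersection of cones around [x]. Nodes of cones through one branch
    form a chain, so the cone of the longest node lies in all the others. *)
Lemma cone_base (U : set (branch_space T)) x : open U -> U x ->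
  exists2 t, nodes T t & cone T t x /\ cone T t `<=` U.
Proof.
case=> D DF <- [V DV Vx].
have [F FT VE] := DF _ DV.
suff [t Tt [tx tV]] : exists2 t, nodes T t & cone T t x /\
    forall C, C \in enum_fset F -> cone T t `<=` C.
  exists t => //; split=> // y ty; have Vy : V y; last by exists V.
  by rewrite -VE => C CF; exact: tV ty.
have {VE Vx} : forall C, C \in enum_fset F ->
    exists2 t, nodes T t & C = cone T t /\ C x.
  move=> C CF; have [t Tt tC] := set_mem (FT _ CF).
  by exists t => //; split=> //; move: Vx; rewrite -VE; apply.
elim: (enum_fset F) => [|C r IH] rT.
  by exists [::]; [exact: node_nil|rewrite cone_nil].
have [|t Tt [tx tr]] := IH; first by move=> B Br; apply: rT; rewrite inE Br orbT.
have [s Ts [CE Cx]] := rT _ (mem_head _ _).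
have [ts|st] := leqP (size t) (size s).
  exists s; rewrite // -CE; split=> // B; rewrite inE => /predU1P[->//|/tr tB].
  rewrite CE; apply: subset_trans tB; apply: coneS.
  by apply: cone_initseg tx _ ts; rewrite -CE.
exists t => //; split=> // B; rewrite inE => /predU1P[->|/tr//].
by rewrite CE; apply: coneS; apply: cone_initseg tx (ltnW st); rewrite -CE.
Qed.

Lemma open_cone t : nodes T t -> open (cone T t : set (branch_space T)).
Proof.
move=> Tt; exists [set cone T t]; last by rewrite bigcup_set1.
move=> _ ->; exists [fset cone T t]%fset; last by rewrite set_fset1 bigcap_set1.
by move=> C /fset1P CE; apply: mem_set; exists t.
Qed.

End tree_combinatorics.

(** * Borel sets as generated by countably many cones *)

Section borel_cones.
Context (A : Type) (T : tree A) (e : seq A -> nat).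
Hypothesis e_inj : {in nodes T &, injective e}.

Lemma countable_bigcup_node (d : measure_display) (X : measurableType d)
    (P : set (seq A)) (F : seq A -> set X) : P `<=` nodes T ->
  (forall t, P t -> measurable (F t)) ->
  measurable (\bigcup_(t in P) F t).
Proof.
move=> PT mF.
(* Sorting the nodes by their code leaves at most one node in each inner union. *)
have -> : \bigcup_(t in P) F t = \bigcup_n \bigcup_(t in P `&` [set t | e t = n]) F t.
  apply/seteqP; split=> [x [t Pt tx]|x [n _ [t [Pt _] tx]]]; last by exists t.
  by exists (e t) => //; exists t.
apply: bigcupT_measurable => n.
have [[t [Pt tn]]|noP] := pselect (exists t, P t /\ e t = n).
  rewrite (_ : _ `&` _ = [set t]) ?bigcup_set1; first exact: mF.
  apply/seteqP; split=> [s [Ps sn]|s ->//].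
  by apply: e_inj; rewrite ?inE ?sn//; exact: PT.
rewrite (_ : _ `&` _ = set0) ?bigcup_set0 //.
by apply/seteqP; split=> // t [Pt tn]; apply: noP; exists t.
Qed.

Lemma measurable_cone t : nodes T t ->
  measurable (cone T t : set (borel_branch_space T)).
Proof. by move=> Tt; apply: sub_sigma_algebra; exact: open_cone. Qed.

(** Two cones are nested or disjoint, so adding [set0] yields a pi-system, as uniqueness of measures
    requires. *)
Definition cones : set (set (borel_branch_space T)) :=
  [set C | C = set0 \/ exists2 t, nodes T t & C = cone T t].

Lemma cones_setI : setI_closed cones.
Proof.
move=> B C [->|[s Ts ->]]; first by rewrite set0I; left.
move=> [->|[t Tt ->]]; first by rewrite setI0; left.
have [->|/set0P[x [sx tx]]] := eqVneq (cone T s `&` cone T t) set0; first by left.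
right; have [st|/ltnW ts] := leqP (size s) (size t).
  by exists t => //; apply/setIidPr; apply: coneS; exact: cone_initseg sx tx st.
by exists s => //; apply/setIidPl; apply: coneS; exact: cone_initseg tx sx ts.
Qed.

Lemma measurable_cones :
  @measurable _ (borel_branch_space T) = <<s cones >>.
Proof.
apply/seteqP; split; last first.
  apply: smallest_sub; first exact: sigma_algebra_measurable.
  move=> _ [->|[t Tt ->]]; [exact: measurable0|exact: measurable_cone].
apply: smallest_sub; first exact: smallest_sigma_algebra.
move=> U Uo; pose X := g_sigma_algebraType cones.
(* An open set is the union of the cones inside it, and there are only countably many. *)
have -> : U = \bigcup_(t in [set t | nodes T t /\ cone T t `<=` U]) cone T t.
  apply/seteqP; split=> [x Ux|x [t [_ tU] /tU]//].
  by have [t Tt [tx tU]] := cone_base Uo Ux; exists t.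
apply: (@countable_bigcup_node _ X) => [t []//|t [Tt _]].
by apply: sub_sigma_algebra; right; exists t.
Qed.

(** By [cone_sep], [h] moves [x] exactly when some cone contains one of [x] and [h x] but not the
    other; this is a countable union. *)
Lemma measurable_neq_id (h : borel_branch_space T -> borel_branch_space T) :
  measurable_fun setT h -> measurable [set x | h x <> x].
Proof.
move=> mh.
have mhC t : nodes T t -> measurable (h @^-1` cone T t).
  by move=> Tt; rewrite -[_ @^-1` _]setTI; apply: mh => //; exact: measurable_cone.
rewrite (_ : [set x | _] = \bigcup_(t in nodes T)
    ((h @^-1` cone T t `\` cone T t) `|` (cone T t `\` h @^-1` cone T t))).
  apply: countable_bigcup_node => // t Tt; have mC := measurable_cone Tt.
  by apply: measurableU; apply: measurableD => //; exact: mhC.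
apply/seteqP; split=> [x hx|x [t Tt [|] [tx ntx]] hx]; last 2 first.
- by apply: ntx; rewrite -hx.
- by apply: ntx; rewrite /= hx.
apply: contrapT => H; apply: hx; apply: cone_sep => t Tt.
by split=> tx; apply: contrapT => ntx; apply: H; exists t => //; [left|right].
Qed.

End borel_cones.

(** * The interval of a node *)

Section interval_scheme.
Context (R : realType) (A : Type) (T : tree A) (e : seq A -> nat).
Context (lambda : probability (borel_branch_space T) R).
Hypothesis e_inj : {in nodes T &, injective e}.
Hypothesis lambda_free : free_measure lambda.
Implicit Types (s t : seq A) (y : R).
Local Notation X := (borel_branch_space T).
Local Notation C t := (cone T t : set X).
Local Open Scope ring_scope.

Definition left_siblings t : set (seq A) :=
  [set v | exists u s, [/\ child T u v, child T u s, initseg s t & (e v < e s)%N]].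

Definition left_of t : set X := \bigcup_(v in left_siblings t) C v.

(** Stages growing from [left_of t] towards [left_of t] with [C t]. A child [s] of [t] occupies the
    step from stage [e s] to stage [(e s).+1], so its [lo] and [hi] are the masses of these two
    stages. *)
Definition left_children t n : set X :=
  left_of t `|` \bigcup_(s in [set s | child T t s /\ (e s < n)%N]) C s.

Lemma left_of_nil : left_of [::] = set0.
Proof.
apply/seteqP; split=> // x [v [u [s [_ [_ [a ->]] /initseg_size]]]].
by rewrite size_rcons.
Qed.

Lemma child_node t s : child T t s -> nodes T t.
Proof.
move=> [Ts [a sE]]; apply: tree_initseg Ts.
by rewrite sE; exact: rcons_initseg.
Qed.

Lemma child_initseg t s : child T t s -> initseg t s.
Proof. by move=> [_ [a ->]]; exact: rcons_initseg. Qed.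

Lemma child_uniq t u s : child T t s -> child T u s -> t = u.
Proof. by move=> [_ [a ->]] [_ [b /rcons_inj[]]]. Qed.

Lemma child_sizeE t s : child T t s -> size s = (size t).+1.
Proof. by move=> [_ [a ->]]; rewrite size_rcons. Qed.

Lemma left_of_child t s : child T t s -> left_of s = left_children t (e s).
Proof.
move=> ts; apply/seteqP; split=> x.
  move=> [v [u [w [uv uw ws vw]]] vx]; have [_ [a sE]] := ts.
  move: (ws); rewrite sE => ws'; have [wE|wt] := initseg_rcons ws'; last first.
    by left; exists v => //; exists u, w.
  right; exists v => //; have {}wE : w = s by rewrite wE.
  by rewrite wE in uw vw; rewrite -sE (child_uniq ts uw).
move=> [[v [u [w [uv uw wt vw]]] vx]|[v [tv vs] vx]]; exists v => //.
  by exists u, w; split=> //; exact: initseg_trans wt (child_initseg ts).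
by exists t, s; split=> //; exact: initseg_refl.
Qed.

Lemma left_childrenS t s : child T t s ->
  left_children t (e s).+1 = left_of s `|` C s.
Proof.
move=> ts; rewrite (left_of_child ts) /left_children -setUA; congr setU.
apply/seteqP; split=> x; last first.
  by move=> [[v [tv vs] vx]|sx]; [exists v => //; split=> //; exact: ltnW|exists s].
move=> [v [tv]]; rewrite /= ltnS leq_eqVlt => /predU1P[vs|vs] vx; last by left; exists v.
right; have <- : v = s by apply: e_inj vs; apply: mem_set; [case: tv|case: ts].
exact: vx.
Qed.

Lemma left_childrenS0 t n : (forall s, child T t s -> e s <> n) ->
  left_children t n.+1 = left_children t n.
Proof.
move=> H; congr setU; congr bigcup; apply/funext => s; apply/propext; split.
  by move=> [ts]; rewrite /= ltnS leq_eqVlt => /predU1P[/(H _ ts)|].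
by move=> [ts sn]; split=> //; exact: ltnW.
Qed.

Lemma left_children0 t : left_children t 0 = left_of t.
Proof.
rewrite /left_children (_ : [set s | _] = set0) ?bigcup_set0 ?setU0 //.
by apply/seteqP; split=> // s [].
Qed.

Lemma left_children_le t n m : (n <= m)%N -> left_children t n `<=` left_children t m.
Proof.
move=> nm x [?|[s [ts sn] sx]]; [by left|right; exists s => //; split=> //].
exact: leq_trans nm.
Qed.

Lemma left_children_sub t n : nodes T t -> left_children t n `<=` left_of t `|` C t.
Proof.
move=> Tt x [?|[s [ts _] sx]]; [by left|right].
exact: coneS (child_initseg ts) _ sx.
Qed.

Lemma left_of_disj t : left_of t `&` C t = set0.
Proof.
apply/seteqP; split=> // x [[v [u [s [uv us st vs]]] vx] tx].
have sx := coneS st tx.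
have vsE := cone_size_inj vx sx (etrans (child_sizeE uv) (esym (child_sizeE us))).
by rewrite vsE ltnn in vs.
Qed.

Lemma measurable_left_of t : measurable (left_of t).
Proof.
apply: (countable_bigcup_node e_inj) => v [u [s [[Tv _] _ _ _]]] //.
exact: measurable_cone.
Qed.

Lemma measurable_left_children t n : measurable (left_children t n).
Proof.
apply: measurableU; first exact: measurable_left_of.
apply: (countable_bigcup_node e_inj) => v [[Tv _] _] //.
exact: measurable_cone.
Qed.

Definition mass (B : set X) : R := fine (lambda B).

Lemma massE B : measurable B -> (mass B)%:E = lambda B.
Proof. by move=> mB; rewrite /mass fineK //; exact: fin_num_measure. Qed.

Lemma mass_le B D : measurable B -> measurable D -> B `<=` D -> mass B <= mass D.
Proof.
by move=> mB mD BD; rewrite -lee_fin !massE //; apply: le_measure; rewrite ?inE.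
Qed.

Definition lo t : R := mass (left_of t).
Definition hi t : R := mass (left_of t `|` C t).

Let mU t : nodes T t -> measurable (left_of t `|` C t).
Proof.
by move=> Tt; apply: measurableU; [exact: measurable_left_of|exact: measurable_cone].
Qed.

Lemma hi_lo t : nodes T t -> hi t = lo t + mass (C t).
Proof.
move=> Tt; have mC := measurable_cone Tt; have mL := measurable_left_of t.
apply: EFin_inj; rewrite EFinD !massE //; last exact: mU.
by rewrite measureU // left_of_disj.
Qed.

Lemma lo_nil : lo [::] = 0.
Proof. by rewrite /lo left_of_nil /mass measure0. Qed.

Lemma hi_nil : hi [::] = 1.
Proof. by rewrite /hi left_of_nil set0U cone_nil /mass probability_setT. Qed.

Lemma lo_ge0 t : 0 <= lo t.
Proof. by rewrite fine_ge0. Qed.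

Lemma lo_le1 t : lo t <= 1.
Proof.
rewrite -lee_fin massE; first exact: probability_le1 (measurable_left_of t).
exact: measurable_left_of.
Qed.

Lemma lo_child t s : child T t s -> lo t <= lo s.
Proof.
move=> ts; rewrite /lo (left_of_child ts); apply: mass_le.
- exact: measurable_left_of.
- exact: measurable_left_children.
- by move=> x; left.
Qed.

Lemma hi_child t s : child T t s -> hi s <= hi t.
Proof.
move=> ts; rewrite /hi -(left_childrenS ts); apply: mass_le.
- exact: measurable_left_children.
- exact: mU (child_node ts).
- exact: left_children_sub (child_node ts).
Qed.

Lemma hi_lo_siblings t s v : child T t s -> child T t v -> (e s < e v)%N ->
  hi s <= lo v.
Proof.
move=> ts tv sv; rewrite /hi /lo -(left_childrenS ts) (left_of_child tv).
apply: mass_le; [exact: measurable_left_children..|exact: left_children_le].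
Qed.

(** At each step either a child has code [n], and the new mass is its [hi], or the stage does not
    change. *)
Lemma left_children_mass_le t y n : lo t <= y ->
  (forall s, child T t s -> (e s < n)%N -> hi s <= y) ->
  mass (left_children t n) <= y.
Proof.
move=> ty; elim: n => [_|n IH H]; first by rewrite left_children0.
have [[s [ts sn]]|nos] := pselect (exists s, child T t s /\ e s = n).
  by rewrite -sn (left_childrenS ts); apply: H => //; rewrite sn.
rewrite left_childrenS0; first by apply: IH => s ts sn; apply: H => //; exact: ltnW.
by move=> s ts sn; apply: nos; exists s.
Qed.

(** The set has at most one element, so freeness applies. *)
Lemma leaf_null t : measurable [set x : X | sval x = inl t] /\
  lambda [set x : X | sval x = inl t] = 0%E.
Proof.
have [[x xt]|nox] := pselect (exists x : X, sval x = inl t).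
  suff -> : [set x : X | sval x = inl t] = [set x] by exact: lambda_free.
  apply/seteqP; split=> [z zt|z -> //]; apply: val_inj.
  by rewrite [LHS]zt [RHS]xt.
suff -> : [set x : X | sval x = inl t] = set0 by rewrite measure0.
by apply/seteqP; split=> // z zt; apply: nox; exists z.
Qed.

Lemma exists_child t y : nodes T t -> lo t <= y < hi t ->
  exists2 s, child T t s & lo s <= y < hi s.
Proof.
move=> Tt /andP[ty yt].
(* Otherwise every stage has mass at most [y]. Continuity from below passes this to the union of the
   stages, which misses at most the null leaf [t], so [hi t <= y]. *)
have [s0 [ts0 ys0]] : exists s, child T t s /\ y < hi s.
  apply: contrapT => nos.
  have below n : mass (left_children t n) <= y.
    apply: left_children_mass_le => // s ts _.
    by rewrite leNgt; apply/negP => ys; apply: nos; exists s.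
  have mL := measurable_left_children t.
  have mBL : measurable (\bigcup_n left_children t n) by exact: bigcupT_measurable.
  have cvgL : (lambda \o left_children t) n @[n --> \oo] -->
      lambda (\bigcup_n left_children t n).
    apply: nondecreasing_cvg_mu => // n m nm.
    exact/subsetPset/left_children_le.
  have leL : (lambda (\bigcup_n left_children t n) <= y%:E)%E.
    rewrite -(cvg_lim _ cvgL) //; apply: lime_le.
      by apply/cvg_ex; exists (lambda (\bigcup_n left_children t n)).
    by apply: nearW => n /=; rewrite -massE // lee_fin.
  have [mleaf leaf0] := leaf_null t.
  suff : (lambda (left_of t `|` C t) <= y%:E)%E.
    by rewrite -massE ?lee_fin; [rewrite leNgt yt|exact: mU].
  apply: le_trans leL; rewrite -[leRHS]adde0 -leaf0.
  apply: le_trans (measureU2 _ mBL mleaf); apply: le_measure; rewrite ?inE.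
  - exact: mU.
  - exact: measurableU.
  - move=> x [tx|tx]; first by left; exists 0%N => //; left.
    have [xt|[s ts sx]] := cone_child Tt tx; [by right|left].
    by exists (e s).+1 => //; right; exists s.
(* Take the child of least code whose [hi] exceeds [y]: all earlier children have [hi] at most [y],
   which bounds its [lo]. *)
have ex : exists n, `[< exists s, [/\ child T t s, y < hi s & e s = n] >].
  by exists (e s0); apply/asboolP; exists s0.
case: (ex_minnP ex) => n /asboolP[s [ts ys sn]] nmin.
exists s => //; rewrite ys andbT /lo (left_of_child ts) sn.
apply: left_children_mass_le => // v tv vn.
rewrite leNgt; apply/negP => yv; move: vn; rewrite ltnNge nmin //.
by apply/asboolP; exists v.
Qed.

(** Induction on the length: the intervals of the parents also contain [y], so the parents agree,
    and distinct siblings have disjoint intervals, ordered by their codes. *)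
Lemma interval_uniq s t y : nodes T s -> nodes T t ->
  lo s <= y < hi s -> lo t <= y < hi t -> size s = size t -> s = t.
Proof.
elim/last_ind: s t => [|s a IH] t; first by move=> _ _ _ _ /esym/size0nil.
case/lastP: t => [|t b]; first by rewrite size_rcons.
move=> Tsa Ttb /andP[sy ys] /andP[ty yt].
rewrite !size_rcons => -[st].
have cs : child T s (rcons s a) by split=> //; exists a.
have ct : child T t (rcons t b) by split=> //; exists b.
have stE : s = t.
  apply: (IH _ (child_node cs) (child_node ct)) => //.
    by rewrite (le_trans (lo_child cs) sy) (lt_le_trans ys (hi_child cs)).
  by rewrite (le_trans (lo_child ct) ty) (lt_le_trans yt (hi_child ct)).
rewrite -stE in ct ty yt Ttb *.
have [ab|ba|ab] := ltngtP (e (rcons s a)) (e (rcons s b)).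
- have := hi_lo_siblings cs ct ab.
  by rewrite leNgt (le_lt_trans ty ys).
- have := hi_lo_siblings ct cs ba.
  by rewrite leNgt (le_lt_trans sy yt).
- by apply: e_inj; rewrite ?inE.
Qed.

(** * From points of [[0, 1[] to branches and back *)

Lemma branch_of_point y : 0 <= y < 1 -> exists2 f : nat -> A, lim_tree T f &
  forall n, lo (mkseq f n) <= y < hi (mkseq f n).
Proof.
move=> y01; have n0 : lo [::] <= y < hi [::] by rewrite lo_nil hi_nil.
(* A child of the root supplies an element of [A], the default of the choice function where no child
   is demanded. *)
have [_ [_ [a0 _]] _] := exists_child (node_nil T) n0.
have /choice[c cP] : forall t, exists a, nodes T t /\ lo t <= y < hi t ->
    nodes T (rcons t a) /\ lo (rcons t a) <= y < hi (rcons t a).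
  move=> t; have [[Tt ty]|] := pselect (nodes T t /\ lo t <= y < hi t).
    have [s [Ts [a sE]] sy] := exists_child Tt ty; exists a.
    by rewrite -sE.
  by exists a0.
pose p n := iter n (fun t => rcons t (c t)) [::].
have pP n : nodes T (p n) /\ lo (p n) <= y < hi (p n).
  by elim: n => [|n /cP//]; split=> //; exact: node_nil.
have pE n : mkseq (c \o p) n = p n by elim: n => // n IH; rewrite mkseqS IH.
by exists (c \o p) => n; rewrite pE; have [] := pP n.
Qed.

(** The cones along [f] decrease to the singleton of [x], which is null; continuity from above does
    the rest. *)
Lemma small_cone x (f : nat -> A) eps : 0 < eps -> lim_tree T f ->
  (forall t, C t x <-> mkseq f (size t) = t) ->
  exists n, mass (C (mkseq f n)) < eps.
Proof.
move=> eps0 Tf xf; apply: contrapT => big.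
have mC n : measurable (C (mkseq f n)) by apply: measurable_cone; exact: Tf.
have [mx x0] := lambda_free x.
have capE : \bigcap_n C (mkseq f n) = [set x].
  apply/seteqP; split=> [z zf|_ -> n _]; last by apply/xf; rewrite size_mkseq.
  apply: cone_sep => t Tt; split=> [tz|/xf <-]; last exact: zf.
  have := zf (size t) I => fz; apply/xf.
  by apply: cone_size_inj fz tz _; rewrite size_mkseq.
have cvgC : (lambda \o (fun n => C (mkseq f n))) n @[n --> \oo] -->
    lambda (\bigcap_n C (mkseq f n)).
  apply: nonincreasing_cvg_mu => //.
  - by have := ltry (mass (C (mkseq f 0))); rewrite massE.
  - by rewrite capE.
  - by move=> n m nm; apply/subsetPset; apply: coneS; exact: initseg_mkseq.
have : (eps%:E <= lambda (\bigcap_n C (mkseq f n)))%E.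
  rewrite -(cvg_lim _ cvgC) //; apply: lime_ge.
    by apply/cvg_ex; exists (lambda (\bigcap_n C (mkseq f n))).
  apply: nearW => n /=; rewrite -massE // lee_fin leNgt.
  by apply/negP => ?; apply: big; exists n.
by rewrite capE x0 lee_fin leNgt eps0.
Qed.

(** The last clause records, through intervals alone, that the cones along the branch of [y] become
    small. Off [[0, 1[] the map is constant, which keeps it measurable. *)
Lemma exists_section : exists g : R -> X,
  [/\ forall y t, 0 <= y < 1 -> nodes T t -> C t (g y) <-> lo t <= y < hi t,
      forall y, ~~ (0 <= y < 1) -> g y = point &
      forall y eps, 0 <= y < 1 -> 0 < eps ->
        exists2 t, nodes T t & lo t <= y < hi t /\ hi t < lo t + eps].
Proof.
have /choice[g gP] : forall y, exists x : X,
    [/\ forall t, 0 <= y < 1 -> nodes T t -> C t x <-> lo t <= y < hi t,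
      ~~ (0 <= y < 1) -> x = point &
      forall eps, 0 <= y < 1 -> 0 < eps ->
        exists2 t, nodes T t & lo t <= y < hi t /\ hi t < lo t + eps].
  move=> y; have [y01|y01] := boolP (0 <= y < 1); last first.
    by exists point; split=> //; rewrite (negbTE y01).
  have [f Tf fy] := branch_of_point y01.
  have [x xf] := lim_tree_branch Tf.
  exists x; split=> // [t _ Tt|eps _ eps0].
    split=> [/xf <-//|ty]; apply/xf.
    by apply: (interval_uniq (Tf _) Tt (fy _) ty); rewrite size_mkseq.
  have [n nP] := small_cone eps0 Tf xf; exists (mkseq f n); first exact: Tf.
  by split; rewrite ?fy// hi_lo ?ltrD2l//; exact: Tf.
by exists g; split=> [y t|y|y eps]; have [H1 H2 H3] := gP y;
  [exact: H1|exact: H2|exact: H3].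
Qed.

(** An analogue of the distribution function of [lambda]: [left_of t] grows with [t] along [x], so
    this is the measure of the union of these sets. *)
Definition cdf_branch (x : X) : R := sup [set lo t | t in [set t | nodes T t /\ C t x]].

Let has_sup_lo x : has_sup [set lo t | t in [set t | nodes T t /\ C t x]].
Proof.
split; last by exists 1 => _ [t _ <-]; exact: lo_le1.
by exists (lo [::]), [::] => //; split; [exact: node_nil|rewrite cone_nil].
Qed.

Lemma cdf_branch_ge t x : nodes T t -> C t x -> lo t <= cdf_branch x.
Proof. by move=> Tt tx; apply: ub_le_sup; [case: (has_sup_lo x)|exists t]. Qed.

Lemma cdf_branch01 x : `[0, 1]%classic (cdf_branch x).
Proof.
rewrite /= in_itv /=; apply/andP; split.
  by rewrite -lo_nil cdf_branch_ge ?cone_nil //; exact: node_nil.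
apply: ge_sup; first by case: (has_sup_lo x).
by move=> _ [t _ <-]; exact: lo_le1.
Qed.

Lemma measurable_cdf_branch : measurable_fun setT cdf_branch.
Proof.
apply: (measurability _ (measurable_realfun.RGenOInfty.measurableE R)) => _ [_ [c ->] <-].
(* A supremum exceeds [c] exactly when one of its terms does. *)
rewrite setTI (_ : _ @^-1` _ = \bigcup_(t in [set t | nodes T t /\ c < lo t]) C t).
  by apply: (countable_bigcup_node e_inj) => t [Tt _] //; exact: measurable_cone.
apply/seteqP; split=> [x|x [t [Tt ct] tx]]; rewrite /= in_itv /= andbT.
  by move=> /(sup_gt (has_sup_lo x).1)[_ [t [Tt tx] <-] ct]; exists t.
exact: lt_le_trans ct (cdf_branch_ge Tt tx).
Qed.

Section section_map.
Context (g : R -> X).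
Hypothesis gP : forall y t, 0 <= y < 1 -> nodes T t ->
  C t (g y) <-> lo t <= y < hi t.
Hypothesis g_out : forall y, ~~ (0 <= y < 1) -> g y = point.
Hypothesis g_small : forall y eps, 0 <= y < 1 -> 0 < eps ->
  exists2 t, nodes T t & lo t <= y < hi t /\ hi t < lo t + eps.

(** The nodes of [g y] are those whose interval contains [y], and these intervals are arbitrarily
    short. *)
Lemma cdf_branch_section y : 0 <= y < 1 -> cdf_branch (g y) = y.
Proof.
move=> y01; apply/eqP; rewrite eq_le; apply/andP; split.
  apply: ge_sup; first by case: (has_sup_lo (g y)).
  by move=> _ [t [Tt /(gP y01 Tt)/andP[ty _]] <-].
apply/ler_addgt0Pr => eps eps0.
have [t Tt [ty te]] := g_small y01 eps0.
have := cdf_branch_ge Tt ((gP y01 Tt).2 ty); case/andP: ty => _ yt.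
by rewrite -(lerD2r eps); apply: le_trans; exact: ltW (lt_trans yt te).
Qed.

Lemma preimage_section t : nodes T t ->
  g @^-1` C t `&` `[0, 1[%classic = `[lo t, hi t[%classic.
Proof.
move=> Tt; apply/seteqP; split=> y; rewrite /= !in_itv /=.
  by move=> [ty y01]; exact/(gP y01 Tt).
move=> ty; have y01 : 0 <= y < 1.
  case/andP: ty => ty yt; rewrite (le_trans (lo_ge0 t) ty) (lt_le_trans yt) //.
  rewrite -lee_fin massE; last exact: mU.
  exact: probability_le1 (mU Tt).
by split=> //; exact/(gP y01 Tt).
Qed.

Lemma measurable_section : measurable_fun [set: measurableTypeR R] g.
Proof.
apply: (measurability _ (measurable_cones e_inj)) => _ [_ [->|[t Tt ->]] <-].
  by rewrite preimage_set0 setI0.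
rewrite setTI -(setIT (g @^-1` _)) -(setUv (`[0, 1[%classic : set R)) setIUr.
apply: measurableU.
  by rewrite preimage_section //; exact: measurable_itv.
(* Off [[0, 1[] the value is [point], so the preimage there is everything or nothing. *)
have [pt|npt] := pselect (C t point).
  rewrite (_ : _ `&` _ = ~` `[0, 1[%classic).
    by apply: measurableC; exact: measurable_itv.
  apply/setIidPr => y /=; rewrite in_itv /= => /negP y01.
  by rewrite g_out.
rewrite (_ : _ `&` _ = set0) //.
apply/seteqP; split=> // y /= [ty /negP]; rewrite in_itv /= => /g_out gy.
by apply: npt; rewrite -gy.
Qed.

Let mI : measurable (`[0, 1[%classic : set (measurableTypeR R)).
Proof. exact: measurable_itv. Qed.

(** Both sides are finite measures in [B] that agree on the pi-system of cones, where the right side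
    is the length of [[lo t, hi t[]. *)
Lemma section_measure (B : set X) : measurable B ->
  lambda B = lebesgue_measure (g @^-1` B `&` `[0, 1[%classic : set (measurableTypeR R)).
Proof.
move=> mB.
pose mu : {measure set (measurableTypeR R) -> \bar R} :=
  mrestr lebesgue_measure mI.
apply: (@measure_unique _ R X (@cones A T) (fun=> setT) (measurable_cones e_inj)
  (@cones_setI _ T) _ _ lambda (pushforward mu g) _ _ B mB).
- by move=> _; right; exists [::]; [exact: node_nil|rewrite cone_nil].
- by rewrite bigcup_const.
- exact: measurable_section.
- move=> ? _ [->|[t Tt ->]]; first by rewrite !measure0.
  transitivity (lebesgue_measure (`[lo t, hi t[%classic : set (measurableTypeR R)));
    last by rewrite -preimage_section.
  rewrite lebesgue_measure_itv /= lte_fin.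
  rewrite -massE; last exact: measurable_cone.
  have := hi_lo Tt; have : 0 <= mass (C t) by exact: fine_ge0.
  (* A null cone has an empty interval, a separate case of the length formula. *)
  rewrite le_eqVlt => /predU1P[<- ->|m0 ->]; first by rewrite addr0 ltxx.
  by rewrite ltrDl m0 -EFinB addrC addKr.
- by move=> _; rewrite -ge0_fin_numE //; exact: fin_num_measure.
Qed.

End section_map.

End interval_scheme.

(** * Tukey connections from two almost inverse maps *)

Lemma tukey_eq_null_ideal (R : realType) (d : measure_display)
    (X : measurableType d) (mu : {measure set X -> \bar R}%R)
    (X0 : [set: X] !=set0) (f : X -> R) (g : R -> X) :
  (forall x, `[0%R, 1%R]%classic (f x)) ->
  (forall M, lebesgue_measure.-negligible M -> mu.-negligible (f @^-1` M)) ->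
  (forall N, mu.-negligible N ->
    lebesgue_measure.-negligible (g @^-1` N `&` `[0%R, 1%R]%classic)) ->
  mu.-negligible [set x | g (f x) <> x] ->
  lebesgue_measure.-negligible ([set y | f (g y) <> y] `&` `[0%R, 1%R]%classic) ->
  tukey_eq (ideal_relsys (null_ideal mu)) (ideal_relsys (null01_ideal R))
  /\ tukey_eq (Cv (null_ideal mu) X0) (Cv (null01_ideal R) (itv01_neq0 R)).
Proof.
move=> f01 fnull gnull gf fg.
pose J : Type := null_ideal mu; pose J01 : Type := null01_ideal R.
have J01P (M : J01) : lebesgue_measure.-negligible (\val M) by have [] := set_valP M.
have JP (N : J) : mu.-negligible (\val N) by exact: set_valP.
pose mk01 (B : set R) (B01 : B `<=` `[0%R, 1%R]%classic)
    (B0 : lebesgue_measure.-negligible B) : J01 :=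
  exist (fun M : set R => M \in ideal_set (null01_ideal R)) B
    (mem_set (conj B01 B0)).
pose mkJ (B : set X) (B0 : mu.-negligible B) : J :=
  exist (fun M : set X => M \in ideal_set (null_ideal mu)) B (mem_set B0).
(* Plain preimages suffice for the covering systems. Between the ideals, a point must be sent across
   and back, so [fpre'] and [gpre'] add the null sets where this fails. *)
pose gpre (N : J) := mk01 _ (@subIsetr _ _ _) (gnull _ (JP N)).
pose fpre (M : J01) := mkJ _ (fnull _ (J01P M)).
pose fpre' (M : J01) := mkJ _ (negligibleU (fnull _ (J01P M)) gf).
have subU01 (B D : set R) : B `&` `[0%R, 1%R]%classic `|` D `&` `[0%R, 1%R]%classic
    `<=` `[0%R, 1%R]%classic by move=> y [] [].
pose gpre' (N : J) := mk01 _ (@subU01 _ _) (negligibleU (gnull _ (JP N)) fg).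
split; split.
- exists gpre, fpre' => N M NM x Nx.
  have [gfx|] := pselect (g (f x) = x); last by right.
  left; apply: NM; split; last exact: f01.
  by rewrite /= gfx.
- exists fpre, gpre' => M N MN y My.
  have y01 : `[0%R, 1%R]%classic y by have [+ _] := set_valP M; apply.
  have [fgy|] := pselect (f (g y) = y); last by right.
  by left; split=> //; apply: MN; rewrite /= fgy.
- by exists (fun x => exist _ (f (\val x)) (mem_set (f01 (\val x)))), fpre.
- exists (fun y => exist _ (g (\val y)) (mem_set I)), gpre => y N Ny.
  by split=> //; exact: set_valP.
Qed.

Theorem theorem7p6 (R : realType) (A : Type) (T : tree A)
    (lambda : probability (borel_branch_space T) R) :
  countable T ->
  free_measure lambda ->
  tukey_eq (ideal_relsys (null_ideal lambda)) (ideal_relsys (null01_ideal R))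
  /\ tukey_eq
       (Cv (null_ideal lambda) (pointed_setT_neq0 (borel_branch_space T)))
       (Cv (null01_ideal R) (itv01_neq0 R)).
Proof.
move=> /countable_injP[e e_inj] free.
have [g [gP g_out g_small]] := exists_section e_inj free.
set f := cdf_branch e lambda.
have fg y : (0 <= y < 1)%R -> f (g y) = y.
  exact: (cdf_branch_section e_inj gP g_small).
have mf : measurable_fun setT f := measurable_cdf_branch lambda e_inj.
have mg : measurable_fun [set: measurableTypeR R] g.
  exact: (measurable_section e_inj gP g_out).
have mfpre B : measurable B -> measurable (f @^-1` B).
  by move=> mB; rewrite -[_ @^-1` _]setTI; exact: mf.
have mgpre B : measurable B -> measurable (g @^-1` B `&` `[0%R, 1%R[%classic).
  move=> mB; apply: measurableI; last exact: measurable_itv.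
  by rewrite -[_ @^-1` _]setTI; exact: mg.
(* [g] inverts only on [[0, 1[]; the endpoint 1 is absorbed as a null singleton. *)
have split01 (B : set R) : B `&` `[0%R, 1%R]%classic `<=`
    (B `&` `[0%R, 1%R[%classic) `|` [set 1%R].
  move=> y [By]; rewrite /= !in_itv /= => /andP[y0].
  by rewrite le_eqVlt => /predU1P[->|y1]; [right|left; rewrite y0].
have null1 : lebesgue_measure.-negligible [set 1%R : R].
  by apply/negligibleP => //; exact: lebesgue_measure_set1.
have gE := section_measure e_inj gP g_out.
apply: (@tukey_eq_null_ideal _ _ _ lambda _ f g).
- exact: (cdf_branch01 lambda e_inj).
- move=> M [B [mB B0 MB]]; have mfB := mfpre _ mB.
  exists (f @^-1` B); split=> //; last by move=> x /MB.
  apply: etrans (gE _ mfB) _; apply: subset_measure0 B0 => //; first exact: mgpre.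
  by move=> y [/=]; rewrite in_itv /= => + y01; rewrite fg.
- move=> N [B [mB B0 NB]]; apply: negligibleS; first exact: split01.
  apply: negligibleU => //.
  exists (g @^-1` B `&` `[0%R, 1%R[%classic); split; first exact: mgpre.
    by rewrite -B0; exact/esym/gE.
  by move=> y [/NB].
- have mgf : measurable [set x | g (f x) <> x].
    apply: (measurable_neq_id e_inj); exact: measurableT_comp mg mf.
  (* Its preimage under [g] in [[0, 1[] is empty, since [f (g y) = y] gives [g (f (g y)) = g y]. *)
  exists [set x | g (f x) <> x]; split=> //; apply: etrans (gE _ mgf) _.
  rewrite (_ : _ `&` _ = set0) ?measure0 //.
  by apply/seteqP; split=> // y [gfy]; rewrite /= in_itv /= => /fg fgy;
    case: (gfy (congr1 g fgy)).
- apply: negligibleS; first exact: split01.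
  apply: negligibleU => //.
  rewrite (_ : _ `&` _ = set0); first exact: negligible_set0.
  by apply/seteqP; split=> // y []; rewrite /= in_itv /= => + /fg.
Qed.
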